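(* Let $n\ge 4$ and $G\cong PO_n^{-,+}(3)$, with $D$ its class of reflections. Then $\varphi(G)=n$ if $n\equiv 0\pmod 3$, $\varphi(G)=n+1$ if $n\equiv 2\pmod 3$, and $\varphi(G)=n+2$ if $n\equiv 1\pmod 3$.
   Context: Let $V$ be the $n$-dimensional orthogonal space over $\mathbb F_3$ with nondegenerate symmetric bilinear form $(\cdot,\cdot)$ whose Gram matrix (in some, equivalently any, basis) has determinant $-1$, and let $Q(v)=2(v,v)=-(v,v)$. $O_n^{-,+}(3)$ is the subgroup of the isometry group of $V$ generated by the reflections $t(v)$ in vectors $v$ with $Q(v)=1$ (equivalently $(v,v)=-1$), $PO_n^{-,+}(3)$ is its image modulo the scalars $\pm 1$, and $D$ is the image of the set of these reflections. $\varphi(G)$ denotes the maximal integer $m$ for which there is an injective homomorphism $S_m\to G$ sending every transposition $(i\,j)$ into $D$. *)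

(* Defs.v *)
From mathcomp Require Import all_boot all_order all_algebra all_fingroup.
From mathcomp Require Import ring.

Set Implicit Arguments.
Unset Strict Implicit.
Unset Printing Implicit Defensive.

Import GroupScope GRing.Theory.
Local Open Scope ring_scope.

Section OrthogonalSpace.

(* The space V is 'rV['F_3]_n, and B is the Gram matrix of its form. The
   dimension is written n.-1.+1, which is n for n > 0, because {'GL_n['F_3]}
   consists of matrices of that size; they act on row vectors on the right. *)
Variables (n : nat) (B : 'M['F_3]_n.-1.+1).
Implicit Types (x y v : 'rV['F_3]_n.-1.+1) (t : {'GL_n['F_3]}).

Definition bform x y : 'F_3 := (x *m B *m y^T) 0 0.

Definition qform v : 'F_3 := 2 * bform v v.

Definition isometries : {set {'GL_n['F_3]}} :=
  [set t : {'GL_n['F_3]} |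
     [forall x, forall y, bform (x *m GLval t) (y *m GLval t) == bform x y]].

Definition is_reflection v t :=
  [forall x, x *m GLval t == x - (2 * bform x v / bform v v) *: v].

Definition reflections : {set {'GL_n['F_3]}} :=
  [set t | [exists v, (qform v == 1) && is_reflection v t]].

(* The group O_n^{-,+}(3) when \det B = -1. *)
Definition refl_group : {group {'GL_n['F_3]}} := <<reflections>>%G.

Definition pm1 : {set {'GL_n['F_3]}} :=
  [set t | (GLval t == 1%:M) || (GLval t == (-1)%:M)].

Lemma pm1_group_set : group_set pm1.
Proof.
apply/group_setP; split=> [|g h]; first by rewrite inE eqxx.
rewrite !inE GL_MxE => /orP[]/eqP-> /orP[]/eqP->;
  by rewrite -scalar_mxM ?mulr1 ?mul1r ?mulrNN ?mulr1 eqxx ?orbT.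
Qed.
Canonical pm1_group := Group pm1_group_set.

Definition PO_group : {group coset_of pm1} := (refl_group / pm1)%G.

Definition PO_reflections : {set coset_of pm1} := coset pm1 @: reflections.

(* Every v with Q(v) = 1 does define an element of reflections, and these are
   isometries, so that refl_group is a group of isometries. *)
Lemma bformDl x y v : bform (x + y) v = bform x v + bform y v.
Proof. by rewrite /bform !mulmxDl mxE. Qed.

Lemma bformZl a x v : bform (a *: x) v = a * bform x v.
Proof. by rewrite /bform -!scalemxAl mxE. Qed.

Lemma bformDr x y v : bform v (x + y) = bform v x + bform v y.
Proof. by rewrite /bform linearD /= mulmxDr mxE. Qed.

Lemma bformZr a x v : bform v (a *: x) = a * bform v x.
Proof. by rewrite /bform linearZ /= -scalemxAr mxE. Qed.

Lemma qform_neq0 v : qform v = 1 -> bform v v != 0.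
Proof.
by move=> Qv; apply/eqP=> B0; move: Qv; rewrite /qform B0 mulr0 => /eqP.
Qed.

Lemma reflection_exists v : qform v = 1 -> exists t, is_reflection v t.
Proof.
move=> /qform_neq0 nz.
pose M := 1%:M - (2 / bform v v) *: (B *m v^T *m v).
have ME x : x *m M = x - (2 * bform x v / bform v v) *: v.
  rewrite /M mulmxBr mulmx1 -scalemxAr !mulmxA [x *m B *m _]mx11_scalar.
  by rewrite mul_scalar_mx scalerA mulrAC.
have MM : M *m M = 1%:M.
  apply/row_matrixP=> i; rewrite !rowE mulmxA mulmx1 !ME -scaleN1r !bformDl.
  set x := delta_mx _ _; rewrite -scaleN1r !bformZl -!addrA -[RHS]addr0.
  congr (_ + _); rewrite !scalerA -scalerDl.
  suff -> : -1 * (2 * bform x v / bform v v) + -1 * (2 * (bform x v +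
     -1 * (2 * bform x v / bform v v * bform v v)) / bform v v) = 0.
    by rewrite scale0r.
  by field.
have uM : M \is a GRing.unit.
  by apply/unitrP; exists M.
by exists (Sub M uM : {'GL_n['F_3]}); apply/forallP=> x; rewrite ME.
Qed.

Lemma reflections_isometries : B^T = B -> reflections \subset isometries.
Proof.
move=> symB; apply/subsetP=> t; rewrite !inE => /existsP[v /andP[/eqP Qv Ht]].
have bC x y : bform x y = bform y x.
  rewrite /bform -{1}symB -[x *m B^T *m _]trmxK mxE !trmx_mul !trmxK.
  by rewrite mulmxA.
apply/forallP=> x; apply/forallP=> y; apply/eqP.
rewrite !(eqP (forallP Ht _)) -!scaleN1r !bformDl !bformZl !bformDr !bformZr.
by rewrite (bC v y); field; exact: qform_neq0.
Qed.

End OrthogonalSpace.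

Section SymmetricSubgroups.

Variables (gT : finGroupType) (G : {group gT}) (D : {set gT}).

Definition sym_embeds (m : nat) : Prop :=
  exists f : {morphism [set: 'S_m] >-> gT},
    [/\ 'injm f, f @* [set: 'S_m] \subset G
      & forall i j : 'I_m, i != j -> f (tperm i j) \in D].

(* The number varphi(G), for G with distinguished set D, is equal to m. *)
Definition varphi_is (m : nat) : Prop :=
  sym_embeds m /\ forall k, sym_embeds k -> (k <= m)%N.

End SymmetricSubgroups.

(* Main.v *)
Require Import Defs.
From mathcomp Require Import all_boot all_order all_algebra all_fingroup.
From mathcomp Require Import ring zify.

(* Upper bound: let S_k embed in G, and let v_1, ..., v_l, with l < k, be the
   roots of the reflections attached to the transpositions (i i+1). Roots of
   commuting reflections are orthogonal and those of non-commuting ones are not,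
   so the Gram matrix of the v_i is tridiagonal with -1 on the diagonal and +-1
   next to it; its determinant is l + 1 whatever the signs (this is the root
   lattice A_l modulo 3). Hence l <= n unless 3 divides l + 1, and if l = n then
   l + 1 is 0 or -1, as \det B = -1.

   Lower bound: take m divisible by 3 with n <= m <= n + 2. If u_1, ..., u_m in V
   satisfy (u_i - u_j, u_i - u_j) = 2 for i <> j, then
     s |-> (x |-> x + \sum_i (x, u_i) (u_(s i) - u_i))
   is a representation of S_m in which (i j) acts as the reflection in u_i - u_j.
   To find the u_i, choose a basis of V in which the form is
   diag(-1, 1, ..., 1), and take the m - 3 basis vectors following the first one
   together with (0; 1, ..., 1, 0, ..., 0), (1; -1, ..., -1, 0, ..., 0) and
   (-1; -1, ..., -1, 0, ..., 0), supported on those and the first one. *)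

Set Implicit Arguments.
Unset Strict Implicit.
Unset Printing Implicit Defensive.

Import GroupScope GRing.Theory.
Local Open Scope ring_scope.

(** * Arithmetic modulo 3, and determinants of Gram matrices of paths *)

Lemma F3P (a : 'F_3) : [\/ a = 0, a = 1 | a = -1].
Proof.
case: a => -[|[|[|//]]] lt_a; [apply: Or31 | apply: Or32 | apply: Or33];
  exact: val_inj.
Qed.

Lemma F3_sqr (a : 'F_3) : a != 0 -> a ^+ 2 = 1.
Proof. by case: (F3P a) => -> //; rewrite ?eqxx // ?sqrrN expr1n. Qed.

Lemma F3_natr k : (k%:R : 'F_3) = (k %% 3)%:R.
Proof.
rewrite {1}(divn_eq k 3) natrD natrM (_ : 3%:R = 0) ?mulr0 ?add0r //.
exact/val_inj.
Qed.

(** Off the diagonal only nonvanishing is asked between neighbours, because a reflection determines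
    its root only up to sign. *)
Definition path_gram l (A : 'M['F_3]_l) :=
  [/\ forall i, A i i = -1,
      forall i j : 'I_l, j = i.+1 :> nat -> A i j != 0 /\ A j i = A i j
    & forall i j : 'I_l, (i.+1 < j)%N -> A i j = 0 /\ A j i = 0].

Lemma path_gram_minor l (A : 'M_l.+1) :
  path_gram A -> path_gram (row' 0 (col' 0 A)).
Proof.
case=> A1 A2 A3; split=> [i | i j ij | i j ij]; rewrite !mxE //.
  by apply: A2; rewrite /= /bump /= !add1n ij.
by apply: A3; rewrite /= /bump /= !add1n ltnS.
Qed.

(** Expansion along the first row gives d_(l+2) = - d_(l+1) - a^2 d_l with a^2 = 1. The sequence l +
    1 satisfies this modulo 3, as three consecutive integers sum to a multiple of 3. *)
Lemma det_path_gram l (A : 'M_l) : path_gram A -> \det A = l.+1%:R.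
Proof.
elim/ltn_ind: l => -[|[|l]] IHl in A *.
- by rewrite det_mx00.
- by case=> A1 _ _; rewrite det_mx11 A1; apply/val_inj.
move=> pA; have [A1 A2 A3] := pA; have pA' := path_gram_minor pA.
have [A01 A10] := A2 ord0 (lift ord0 ord0) erefl.
rewrite (expand_det_row _ ord0) !big_ord_recl big1 ?addr0 => [|j _]; last first.
  by rewrite (A3 ord0 _ _).1 ?mul0r.
rewrite A1 /cofactor IHl // expr0 /=.
set M := row' ord0 (col' (lift ord0 ord0) A).
have lift01 : lift (lift ord0 ord0) ord0 = ord0 :> 'I_l.+2 by exact/val_inj.
have -> : \det M = A ord0 (lift ord0 ord0) * l.+1%:R.
  rewrite (expand_det_col _ ord0) big_ord_recl big1 ?addr0 => [|j _];
    last first.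
    by rewrite [M _ _]mxE mxE lift01 (A3 ord0 _ _).2 ?mul0r.
  rewrite /cofactor expr0 mul1r [M _ _]mxE mxE lift01 A10.
  rewrite -(IHl l _ (row' ord0 (col' ord0 (row' ord0 (col' ord0 A))))) //;
    last exact: path_gram_minor.
  congr (_ * \det _); apply/matrixP=> i j; rewrite !mxE.
  by congr (A _ _); apply/val_inj.
rewrite /bump /= expr1.
transitivity (- (l.+2%:R + A ord0 (lift ord0 ord0) ^+ 2 * l.+1%:R) : 'F_3).
  by ring.
rewrite F3_sqr // mul1r -natrD.
rewrite -[RHS]opprK; congr (- _); apply/eqP.
rewrite -subr_eq0 opprK -natrD F3_natr.
rewrite (_ : (l.+2 + l.+1 + l.+3) = (l.+2 * 3))%N; last lia.
by rewrite modnMl.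
Qed.

(** The Gram matrix factors through [V], so an invertible one forces [V] to have rank [l]. *)
Lemma path_gram_rank l n (B : 'M['F_3]_n) (V : 'M_(l, n)) :
  path_gram (V *m B *m V^T) -> l.+1%:R != 0 :> 'F_3 -> (l <= n)%N.
Proof.
move=> /det_path_gram detV nz.
have : V *m B *m V^T \in unitmx by rewrite unitmxE detV unitfE.
rewrite -row_free_unit -mulmxA => /eqP <-.
exact: leq_trans (mxrankM_maxl _ _) (rank_leq_col _).
Qed.

(** The determinant equals - (det V)^2, and the squares in ['F_3] are 0 and 1. *)
Lemma path_gram_disc n (B V : 'M['F_3]_n) :
  path_gram (V *m B *m V^T) -> \det B = -1 -> n.+1%:R != 1 :> 'F_3.
Proof.
move=> /det_path_gram <- detB.
rewrite !det_mulmx det_tr detB mulrN1 mulNr -expr2.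
by have [-> | /F3_sqr->] := eqVneq (\det V) 0; apply/eqP=> /val_eqP.
Qed.

(** * Bilinear form and reflections in vectors of norm -1 *)

Lemma GL_eqP n (s t : {'GL_n['F_3]}) :
  (forall x : 'rV_n.-1.+1, x *m GLval s = x *m GLval t) -> s = t.
Proof.
move=> eq_st; apply/val_inj/row_matrixP=> i /=; rewrite !rowE.
exact: eq_st.
Qed.

Lemma bformC n (B : 'M['F_3]_n.-1.+1) x y :
  B^T = B -> bform B x y = bform B y x.
Proof.
move=> symB; rewrite /bform -{1}symB -[x *m B^T *m _]trmxK mxE !trmx_mul !trmxK.
by rewrite mulmxA.
Qed.

Lemma bformBl n (B : 'M['F_3]_n.-1.+1) x y v :
  bform B (x - y) v = bform B x v - bform B y v.
Proof. by rewrite -scaleN1r bformDl bformZl mulN1r. Qed.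

Lemma bformBr n (B : 'M['F_3]_n.-1.+1) x y v :
  bform B v (x - y) = bform B v x - bform B v y.
Proof. by rewrite -scaleN1r bformDr bformZr mulN1r. Qed.

Lemma mulmx_bform n (B : 'M['F_3]_n.-1.+1) l (V : 'M_(l, n.-1.+1)) i j :
  (V *m B *m V^T) i j = bform B (row i V) (row j V).
Proof.
by rewrite /bform tr_row -row_mul !mxE; apply: eq_bigr => k _; rewrite !mxE.
Qed.

Lemma qform_bform n (B : 'M['F_3]_n.-1.+1) v :
  (qform B v == 1) = (bform B v v == -1).
Proof. by rewrite /qform; case: (F3P (bform B v v)) => ->. Qed.

(** For (v, v) = -1 the factor 2 / (v, v) is -2 = 1 in ['F_3]. *)
Lemma is_reflectionP n (B : 'M['F_3]_n.-1.+1) v t : bform B v v = -1 ->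
  reflect (forall x, x *m GLval t = x - bform B x v *: v) (is_reflection B v t).
Proof.
move=> Bv; have E x : 2 * bform B x v / bform B v v = bform B x v.
  by rewrite Bv; case: (F3P (bform B x v)) => ->; apply/val_inj.
by apply: (iffP forallP) => H x; [rewrite (eqP (H x)) E | rewrite H E].
Qed.

Lemma reflectionsP n (B : 'M['F_3]_n.-1.+1) t :
  reflect (exists2 v, bform B v v = -1 &
             forall x, x *m GLval t = x - bform B x v *: v)
          (t \in reflections B).
Proof.
rewrite inE; apply: (iffP existsP) => -[v].
  rewrite qform_bform => /andP[/eqP Bv /(is_reflectionP _ Bv) Ht].
  by exists v.
by move=> Bv Ht; exists v; rewrite qform_bform Bv eqxx; apply/is_reflectionP.
Qed.

Lemma is_reflection_mulE n (B : 'M['F_3]_n.-1.+1) v w s t :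
  (forall x, x *m GLval s = x - bform B x v *: v) ->
  (forall x, x *m GLval t = x - bform B x w *: w) ->
  forall x, x *m GLval (s * t) =
    x - bform B x v *: v - bform B x w *: w + (bform B x v * bform B v w) *: w.
Proof.
move=> sE tE x; rewrite GL_MxE mulmxA tE sE.
by rewrite bformBl bformZl scalerBl opprB addrA addrAC.
Qed.

(** * Commutation of two reflections, exactly and up to sign *)

Section TwoReflections.

Variables (n : nat) (B : 'M['F_3]_n.-1.+1) (symB : B^T = B).
Variables (v w : 'rV['F_3]_n.-1.+1) (s t : {'GL_n['F_3]}).
Hypothesis (Bv : bform B v v = -1).
Hypothesis (sE : forall x, x *m GLval s = x - bform B x v *: v).
Hypothesis (tE : forall x, x *m GLval t = x - bform B x w *: w).

Let stE := is_reflection_mulE sE tE.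
Let tsE := is_reflection_mulE tE sE.

Lemma orthogonal_reflections_commute : bform B v w = 0 -> commute s t.
Proof.
move=> Bvw; apply: GL_eqP => x; rewrite stE tsE (bformC w v symB) Bvw !mulr0.
by rewrite !scale0r !addr0 addrAC.
Qed.

(** If (v, w) is nonzero, evaluating st = ts at v gives v = - (v, w) w; proportional roots define
    the same reflection. *)
Lemma commuting_reflections_orthogonal :
  s != t -> commute s t -> bform B v w = 0.
Proof.
move=> neq_st cst; apply: contraNeq neq_st => Bvw; apply/eqP.
have eq_vw : v = - bform B v w *: w.
  have := stE v; rewrite cst tsE (bformC w v symB) Bv -expr2 F3_sqr //.
  rewrite mulN1r scaleN1r opprK scale1r scaleNr.
  by rewrite [v - _ + v]addrAC => /addrI.
apply: GL_eqP => x; rewrite sE tE eq_vw bformZr scalerA; congr (_ - _ *: _).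
by rewrite mulrAC mulrNN -expr2 F3_sqr ?mul1r.
Qed.

(* st + ts = 0 makes 2x a combination of v and w for every x. *)
Lemma anticommuting_reflections_small (z : {'GL_n['F_3]}) :
  (forall x : 'rV_n.-1.+1, x *m GLval z = - x) ->
  (s * t = z * (t * s))%g -> (n.-1.+1 <= 2)%N.
Proof.
move=> zE eq_st.
have sub (x : 'rV['F_3]_n.-1.+1) : (x <= v + w)%MS.
  have inS a b : ((a *: v + b *: w)%R <= v + w)%MS.
    by apply: addmx_sub_adds; apply: scalemx_sub.
  have := stE x; rewrite eq_st GL_MxE mulmxA zE tsE.
  have bN u : bform B (- x) u = - bform B x u.
    by rewrite -scaleN1r bformZl mulN1r.
  rewrite !bN.
  set a := bform _ x v; set b := bform _ x w; set c := bform _ v w.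
  set c' := bform _ w v => eq_x.
  (* Solving for -2x gives these coefficients, and -2 = 1 in ['F_3]. *)
  suff -> : x = (b * c' - a *+ 2) *: v + (a * c - b *+ 2) *: w by exact: inS.
  apply/rowP=> i; have /eqP := congr1 (fun y : 'rV_n.-1.+1 => y 0 i) eq_x.
  rewrite !mxE -subr_eq0 => /eqP eq_xi.
  have x3 : x 0 i * 3 = 0 by case: (F3P (x 0 i)) => ->; apply/val_inj.
  apply/eqP; rewrite -subr_eq0; apply/eqP.
  by rewrite -[RHS](addr0 (0 : 'F_3)) -{1}x3 -eq_xi; ring.
rewrite -(mxrank1 'F_3 n.-1.+1).
have : (1%:M <= v + w)%MS by apply/row_subP.
move/mxrankS/leq_trans; apply.
rewrite (leq_trans (mxrank_adds_leqif _ _)) // (leq_add (rank_leq_row _)) //.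
exact: rank_leq_row.
Qed.

End TwoReflections.

(** * The scalars 1 and -1, and the quotient by them *)

Lemma pm1P n (z : {'GL_n['F_3]}) : z \in pm1 n ->
  z = 1%g \/ (forall x : 'rV_n.-1.+1, x *m GLval z = - x).
Proof.
rewrite inE => /orP[]/eqP Ez; [left; exact: val_inj | right => x].
by rewrite Ez mul_mx_scalar scaleN1r.
Qed.

Lemma pm1_central n (s z : {'GL_n['F_3]}) : z \in pm1 n -> commute s z.
Proof.
case/pm1P=> [-> | zE]; first exact: commute1.
by apply: GL_eqP => x; rewrite GL_MxE mulmxA zE GL_MxE mulmxA zE mulNmx.
Qed.

Lemma pm1_norm n (s : {'GL_n['F_3]}) : s \in 'N(pm1 n).
Proof.
by apply: (subsetP (cent_sub _)); apply/centP=> z; exact: pm1_central.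
Qed.

Lemma coset_pm1P n (s t : {'GL_n['F_3]}) :
  reflect (exists2 z, z \in pm1 n & s = (z * t)%g)
          (coset (pm1 n) s == coset (pm1 n) t).
Proof.
apply: (iffP eqP) => [/rcoset_kercosetP | [z pz ->]].
  by rewrite !pm1_norm => /(_ isT isT)/rcosetP.
by apply/rcoset_kercosetP; rewrite ?pm1_norm //; apply/rcosetP; exists z.
Qed.

(** * From an embedding of a symmetric group to a path of roots *)

Section Embedding.

Variables (n : nat) (B : 'M['F_3]_n.-1.+1).
Variables (gT : finGroupType) (G : {group gT}).
Variables (f : {morphism PO_group B >-> gT}) (isoG : isom (PO_group B) G f).

Let injf : 'injm f. Proof. by case/isomP: isoG. Qed.

Lemma reflections_PO r : r \in reflections B -> coset (pm1 n) r \in PO_group B.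
Proof. by move=> Rr; apply: mem_morphim; rewrite ?pm1_norm ?mem_gen. Qed.

(** Injectivity of [F] and [f] carries commutation both ways between transpositions and cosets of
    reflections. Commuting cosets only say that the reflections commute up to sign; the sign -1 is
    excluded because it would bound the dimension by 2. *)
Lemma embedded_roots_gram k l : B^T = B -> (3 <= n)%N -> (l < k)%N ->
    sym_embeds G (f @: PO_reflections B) k ->
  exists V : 'M_(l, n.-1.+1), path_gram (V *m B *m V^T).
Proof.
move=> symB n3 lk [F [injF _ FD]].
have n2 : ~~ (n.-1.+1 <= 2)%N by lia.
pose lo (i : 'I_l) : 'I_k := widen_ord (ltnW lk) i.
pose hi (i : 'I_l) : 'I_k := Ordinal (leq_ltn_trans (ltn_ord i) lk).
pose s i := tperm (lo i) (hi i).
have lohi i : lo i != hi i by rewrite -val_eqE /= neq_ltn ltnSn.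
have /fin_all_exists[rv rvP] i : exists rv : {'GL_n['F_3]} * 'rV['F_3]_n.-1.+1,
    [/\ F (s i) = f (coset (pm1 n) rv.1), rv.1 \in reflections B,
        bform B rv.2 rv.2 = -1
      & forall x, x *m GLval rv.1 = x - bform B x rv.2 *: rv.2].
  have /imsetP[_ /imsetP[r Rr ->] Fs] := FD _ _ (lohi i).
  have /reflectionsP[v Bv rE] := Rr.
  by exists (r, v).
have coset_comm i j : commute (s i) (s j) <->
    commute (coset (pm1 n) (rv i).1) (coset (pm1 n) (rv j).1).
  have [Fi /reflections_PO Ri _ _] := rvP i.
  have [Fj /reflections_PO Rj _ _] := rvP j.
  split=> cst.
    apply: (injmP injf); rewrite ?groupM // !morphM // -Fi -Fj.
    by rewrite -!morphM ?inE // cst.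
  apply: (injmP injF); rewrite ?inE // !morphM ?inE // Fi Fj.
  by rewrite -[LHS]morphM // -[RHS]morphM // cst.
exists (\matrix_i (rv i).2).
split=> [i | i j ij | i j ij]; rewrite !mulmx_bform !rowK.
- by case: (rvP i).
- split; last exact: bformC.
  have [_ _ Bi iE] := rvP i; have [_ _ Bj jE] := rvP j.
  apply/eqP=> /(orthogonal_reflections_commute symB iE jE) cij.
  have hl : hi i = lo j by exact/val_inj.
  (* The two products differ at [lo i]: one sends it to [hi j], the other to [hi i]. *)
  have /(congr1 (fun p : 'S_k => p (lo i))) : commute (s i) (s j).
    apply/coset_comm.
    by rewrite /commute -[LHS]morphM ?pm1_norm // cij morphM ?pm1_norm.
  have fix_lo : s j (lo i) = lo i.
    by rewrite tpermD // -val_eqE /= ij; lia.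
  rewrite !permM fix_lo !tpermL hl tpermL.
  by move/(congr1 val)=> /=; lia.
have lohiD : [/\ lo i != lo j, lo i != hi j, hi i != lo j & hi i != hi j].
  by rewrite -!val_eqE /=; split; lia.
case: lohiD => ll lh hl hh.
have sij : commute (s i) (s j).
  by apply/commgP/conjg_fixP; rewrite tpermJ !tpermD // eq_sym.
have neq_s : s i != s j.
  apply/eqP=> /(congr1 (fun p : 'S_k => p (lo i)))/eqP.
  by rewrite tpermL tpermD 1?eq_sym ?(negbTE (lohi i)) // eq_sym.
have [Fi Ri Bi iE] := rvP i; have [Fj Rj Bj jE] := rvP j.
suff Bij : bform B (rv i).2 (rv j).2 = 0.
  by rewrite (bformC (rv j).2 _ symB) Bij.
have /coset_comm cij := sij.
have /coset_pm1P[z pz eq_rij] : coset (pm1 n) ((rv i).1 * (rv j).1) ==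
    coset (pm1 n) ((rv j).1 * (rv i).1).
  by rewrite [coset _ _]morphM ?pm1_norm // cij -morphM ?pm1_norm.
have [z1 | zE] := pm1P pz.
  rewrite z1 mul1g in eq_rij.
  apply: (commuting_reflections_orthogonal symB Bi iE jE).
    apply: contraNneq neq_s => eq_r; apply/eqP.
    apply: (injmP injF); rewrite ?inE //.
    by rewrite Fi Fj eq_r.
  exact: eq_rij.
by rewrite (anticommuting_reflections_small iE jE zE eq_rij) in n2.
Qed.

End Embedding.

(** * The representation of S_m attached to m equidistant vectors *)

Lemma ex_notin m (r : seq 'I_m) : (size r < m)%N -> exists i, i \notin r.
Proof.
move=> small_r; apply/existsP; apply: contraLR small_r.
rewrite negb_exists -leqNgt => /forallP all_r.
rewrite -[X in (X <= _)%N](size_enum_ord m).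
apply: (uniq_leq_size (enum_uniq 'I_m)) => i _.
by rewrite -[_ \in r]negbK all_r.
Qed.

Section Construction.

Variables (n m : nat) (B : 'M['F_3]_n.-1.+1).
Variables (U : 'M['F_3]_(m, n.-1.+1)) (a : 'cV['F_3]_m).
(* Says that the differences of the rows u_i of U have norm 2; a_i is then
   ((u_i, u_i) - 1) / 2. *)
Hypothesis UBU : U *m B *m U^T = 1%:M + (a *m const_mx 1 + (a *m const_mx 1)^T).

Let P (s : 'S_m) : 'M['F_3]_m := perm_mx s - 1%:M.

(** For a row vector x, the entries of [x *m B *m U^T] are the (x, u_i), and the rows of [P s *m U]
    are the u_(s i) - u_i; [sym_GLE] recovers the formula with a sum. *)
Definition sym_mx (s : 'S_m) : 'M['F_3]_n.-1.+1 := 1%:M + B *m U^T *m P s *m U.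

Lemma perm_mx_const s : perm_mx s *m const_mx 1 = const_mx 1 :> 'cV['F_3]_m.
Proof. by rewrite -row_permE; apply/matrixP=> i j; rewrite !mxE. Qed.

Lemma const_perm_mx s : const_mx 1 *m perm_mx s = const_mx 1 :> 'rV['F_3]_m.
Proof.
by rewrite -{1}[s]invgK -col_permE; apply/matrixP=> i j; rewrite !mxE.
Qed.

(** Both rank-one terms of the Gram matrix vanish here: [X] kills the all-ones column and [P s] the
    all-ones row. The Gram matrix thus acts as the identity. *)
Lemma sum0_UBU_P p (X : 'M_(p, m)) s : X *m (const_mx 1 : 'cV_m) = 0 ->
  X *m (U *m B *m U^T) *m P s = X *m P s.
Proof.
have : (const_mx 1 : 'rV_m) *m P s = 0.
  by rewrite mulmxBr const_perm_mx mulmx1 subrr.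
rewrite UBU; move: (P s) => Y cY Xc.
rewrite !mulmxDr mulmx1 !mulmxDl trmx_mul trmx_const !mulmxA Xc !mul0mx addr0.
by rewrite -[_ *m _ *m Y]mulmxA cY mulmx0 addr0.
Qed.

Lemma P_UBU_P s t : P s *m (U *m B *m U^T) *m P t = P s *m P t.
Proof.
by rewrite sum0_UBU_P // mulmxBl perm_mx_const mul1mx subrr.
Qed.

(** As P(st) = P(s) + P(t) + P(s) P(t), it remains to identify the quadratic terms, which is
    [P_UBU_P]. *)
Lemma sym_mxM s t : sym_mx (s * t)%g = sym_mx s *m sym_mx t.
Proof.
have PM : P (s * t)%g = P s + P t + P s *m P t.
  rewrite /P perm_mxM mulmxBl !mulmxBr !mulmx1 !mul1mx.
  move: (perm_mx s) (perm_mx t) (perm_mx s *m _) => X Y Z.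
  by apply/matrixP=> i j; rewrite !mxE; ring.
move: (P_UBU_P s t); rewrite /sym_mx PM; move: (P s) (P t) => X Y XY.
have -> : B *m U^T *m (X + Y + X *m Y) *m U = B *m U^T *m X *m U
    + B *m U^T *m Y *m U + B *m U^T *m X *m U *m (B *m U^T *m Y *m U).
  by rewrite -XY !mulmxDr !mulmxDl !mulmxA.
by rewrite mulmxDl mul1mx mulmxDr mulmx1 !addrA (addrAC 1%:M).
Qed.

Lemma sym_mx1 : sym_mx 1 = 1%:M.
Proof. by rewrite /sym_mx /P perm_mx1 subrr mulmx0 mul0mx addr0. Qed.

Lemma sym_mx_unit s : sym_mx s \is a GRing.unit.
Proof.
apply/unitrP; exists (sym_mx s^-1).
by rewrite -!mulmxE -!sym_mxM mulVg mulgV sym_mx1.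
Qed.

Definition sym_GL s : {'GL_n['F_3]} := Sub (sym_mx s) (sym_mx_unit s).

Lemma sym_GLM s t : sym_GL (s * t) = (sym_GL s * sym_GL t)%g.
Proof. by apply/val_inj; exact: sym_mxM. Qed.

Lemma bform_row i j :
  bform B (row i U) (row j U) = (i == j)%:R + (a i 0 + a j 0).
Proof. by rewrite -mulmx_bform UBU !mxE !big_ord1 !mxE !mulr1. Qed.

(** The contributions of [a] cancel, leaving the inner products of e_i - e_j and e_k - e_l in the
    root lattice A_(m-1). *)
Lemma bform_diff i j k l :
  bform B (row i U - row j U) (row k U - row l U) =
  (i == k)%:R - (i == l)%:R - (j == k)%:R + (j == l)%:R.
Proof.
by rewrite bformBl !bformBr !bform_row; ring.
Qed.

Lemma sym_GLE s x : x *m GLval (sym_GL s) =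
  x + \sum_i bform B x (row i U) *: (row (s i) U - row i U).
Proof.
rewrite /= /sym_mx mulmxDr mulmx1; congr (_ + _).
rewrite !mulmxA -(mulmxA _ _ U) mulmx_sum_row.
apply: eq_bigr => i _; congr (_ *: _).
  by rewrite /bform tr_row !mxE; apply: eq_bigr => k _; rewrite !mxE.
by rewrite mulmxBl mul1mx -row_permE; apply/rowP=> k; rewrite !mxE.
Qed.

Hypothesis m4 : (4 < m)%N.

Lemma sym_GL_tperm i j : i != j -> sym_GL (tperm i j) \in reflections B.
Proof.
move=> neq_ij; apply/reflectionsP; exists (row i U - row j U).
  (* The norm is 2, which is -1 in ['F_3]. *)
  rewrite bform_diff !eqxx (negbTE neq_ij) eq_sym (negbTE neq_ij).
  exact/val_inj.
move=> x; rewrite sym_GLE (bigD1 i) // (bigD1 j) 1?eq_sym //= big1 => [|k].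
  rewrite tpermL tpermR addr0 bformBr scalerBl -(opprB (row i U)) scalerN.
  by rewrite opprB addrC.
by case/andP=> ki kj; rewrite tpermD 1?eq_sym // subrr scaler0.
Qed.

Lemma sym_GL_row s i j :
  (row i U - row j U) *m GLval (sym_GL s) = row (s i) U - row (s j) U.
Proof.
have -> k l : row k U - row l U = (delta_mx 0 k - delta_mx 0 l) *m U.
  by rewrite mulmxBl -!rowE.
set d : 'rV_m := _ - _; have d0 : d *m (const_mx 1 : 'cV_m) = 0.
  by rewrite mulmxBl -!rowE; apply/rowP=> k; rewrite !mxE subrr.
rewrite /= /sym_mx mulmxDr mulmx1.
have -> : d *m U *m (B *m U^T *m P s *m U) = d *m (U *m B *m U^T) *m P s *m U.
  by rewrite !mulmxA.
rewrite sum0_UBU_P // -mulmxDl mulmxBr mulmx1 addrC subrK -mulmxA -row_permE.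
by rewrite mulmxBl -!rowE; congr (_ - _); apply/rowP=> k; rewrite !mxE.
Qed.

Lemma sym_GL_refl_group s : sym_GL s \in refl_group B.
Proof.
have [ts -> /allP dts] := prod_tpermP s.
elim: ts dts => [|[i j] ts IHts] dts.
  rewrite big_nil (_ : sym_GL 1 = 1%g) ?group1 //.
  by apply/val_inj; exact: sym_mx1.
rewrite big_cons sym_GLM groupM ?IHts // => [|t ts_t].
  by rewrite mem_gen // sym_GL_tperm //; apply: (dts (i, j)); rewrite mem_head.
by apply: dts; rewrite inE ts_t orbT.
Qed.

(** Suppose s acts as a scalar e and moves j. For suitable k and l, pairing the image of u_j - u_l
    with u_j - u_k gives e by scaling, but 0 from the permuted indices. *)
Lemma sym_GL_inj s : sym_GL s \in pm1 n -> s = 1%g.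
Proof.
move=> pm_s; have [e nz_e sE] : exists2 e : 'F_3, e != 0 &
    forall x : 'rV_n.-1.+1, x *m GLval (sym_GL s) = e *: x.
  have [-> | sE] := pm1P pm_s.
    by exists 1 => // x; rewrite mulmx1 scale1r.
  by exists (-1) => // x; rewrite sE scaleN1r.
apply/permP=> j; rewrite perm1; apply: contraNeq nz_e => sj.
have [|k] := ex_notin (r := [:: j; s j]); first by rewrite (leq_trans _ m4).
(* Four indices have to be avoided, whence the bound [4 < m]. *)
have [|l] := ex_notin (r := [:: j; k; s^-1 j; s^-1 k]%g) => //.
rewrite !inE !negb_or => /and4P[lj lk lsj lsk] /andP[kj ksj].
have slj : s l != j by apply: contraNneq lsj => <-; rewrite permK.
have slk : s l != k by apply: contraNneq lsk => <-; rewrite permK.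
have := bform_diff (s j) (s l) j k.
rewrite -sym_GL_row sE bformZl bform_diff.
rewrite eqxx (negbTE sj) (negbTE slj) (negbTE slk) (negbTE lj) (negbTE lk).
rewrite (eq_sym j k) (eq_sym _ k) (negbTE kj) (negbTE ksj) !subr0 !addr0 mulr1.
by move->.
Qed.

End Construction.

Lemma equidistant_embeds n m (B : 'M['F_3]_n.-1.+1)
    (U : 'M['F_3]_(m, n.-1.+1)) (a : 'cV_m)
    (gT : finGroupType) (G : {group gT}) (f : {morphism PO_group B >-> gT}) :
    isom (PO_group B) G f ->
    U *m B *m U^T = 1%:M + (a *m const_mx 1 + (a *m const_mx 1)^T) ->
    (4 < m)%N ->
  sym_embeds G (f @: PO_reflections B) m.
Proof.
move=> /isomP[injf imf] UBU m4; pose h s := f (coset (pm1 n) (sym_GL UBU s)).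
have PO_h s : coset (pm1 n) (sym_GL UBU s) \in PO_group B.
  by apply: mem_morphim; rewrite ?pm1_norm ?sym_GL_refl_group.
have hM : {in [set: 'S_m] &, {morph h : s t / (s * t)%g}}.
  move=> s t _ _; rewrite /h sym_GLM [coset _ _]morphM ?pm1_norm //.
  by rewrite [LHS]morphM; [ | exact: PO_h ..].
exists (Morphism hM); split.
- apply/injmP=> s t _ _ /= /(injmP injf _ _ (PO_h s) (PO_h t)) eq_st.
  apply/eqP; rewrite eq_mulgV1.
  apply/eqP/(sym_GL_inj (UBU := UBU) m4).
  have /coset_pm1P[z pz eq_z] := introT eqP eq_st.
  suff ->: sym_GL UBU (s * t^-1) = z by [].
  apply: (mulIg (sym_GL UBU t)); rewrite -eq_z -sym_GLM.
  by rewrite mulgKV.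
- rewrite morphimE /= setIid -imf; apply/subsetP=> _ /imsetP[s _ ->].
  exact: mem_morphim.
- move=> i j neq_ij; do 2!apply: imset_f; exact: sym_GL_tperm.
Qed.

(** * Diagonalization of symmetric forms over ['F_3] *)

Lemma diag_mx_perm k (s : 'S_k) (r : 'rV['F_3]_k) :
  perm_mx s *m diag_mx r *m (perm_mx s)^T = diag_mx (col_perm s r).
Proof.
rewrite -row_permE tr_perm_mx -col_permE; apply/matrixP=> i j; rewrite !mxE.
by rewrite (inj_eq perm_inj).
Qed.

Lemma norm1_exists n (B : 'M['F_3]_n.-1.+1) : (1 < n)%N -> B^T = B ->
  B \in unitmx -> exists v, bform B v v = 1.
Proof.
move=> n1 symB uB.
suff /existsP[v /eqP] : [exists v, bform B v v == 1] by exists v.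
have [//|/existsPn no1] := boolP [exists v, bform B v v == 1].
(* Two orthogonal vectors of norm -1 have a sum of norm 1; so if there is no
   vector of norm 1, the form has rank at most 1. *)
have [x qE] : exists x : 'cV_n.-1.+1,
    forall w, bform B w w = - ((w *m x) 0 0) ^+ 2.
  have [/existsP[v nz_v] | /existsPn q0] := boolP [exists v, bform B v v != 0];
    last first.
    exists 0 => w; rewrite mulmx0 mxE expr0n oppr0; apply/eqP.
    by rewrite -[_ == _]negbK q0.
  have qv : bform B v v = -1.
    by have := no1 v; case: (F3P (bform B v v)) nz_v => ->.
  exists (B *m v^T) => w; rewrite mulmxA -[(_ *m _) 0 0]/(bform B w v).
  (* Since (v, v) = -1, this is the component of [w] orthogonal to [v]. *)
  pose w' := w + bform B w v *: v.
  have q' : bform B w' w' = bform B w w + bform B w v ^+ 2.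
    rewrite /w' bformDl !bformDr !bformZl !bformZr qv (bformC v w symB); ring.
  have bw' : bform B v w' = 0.
    by rewrite /w' bformDr bformZr qv (bformC v w symB) mulrN1 subrr.
  clearbody w'; have : bform B w' w' = 0.
    case: (F3P (bform B w' w')) => // [q1 | qN].
      by have := no1 w'; rewrite q1.
    have := no1 (v + w'); rewrite bformDl !bformDr (bformC w' v symB).
    by rewrite qv qN bw' addr0 add0r => /negP[]; apply/eqP/val_inj.
  by rewrite q' => /eqP; rewrite addr_eq0 => /eqP.
(* Polarization of [qE]; it exhibits [B] as a matrix of rank at most 1. *)
have bE w u : bform B w u = - ((w *m x) 0 0 * (u *m x) 0 0).
  have := qE (w + u); rewrite bformDl !bformDr (bformC u w symB) !qE mulmxDl.
  rewrite [fun_of_matrix (_ + _) _ _]mxE.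
  move: (bform B w u) ((w *m x) 0 0) ((u *m x) 0 0) => c y z.
  by case: (F3P c) => ->; case: (F3P y) => ->; case: (F3P z) => -> /eqP //= _;
    apply/val_inj.
have BE : B = - x *m x^T.
  apply/matrixP=> i j; have := bE (delta_mx 0 i) (delta_mx 0 j).
  rewrite /bform trmx_delta -!rowE -colE.
  rewrite [X in X = _]mxE [X in X = _]mxE ![row _ x _ _]mxE => ->.
  by rewrite !mxE big_ord1 !mxE mulNr.
have : (n.-1.+1 <= 1)%N.
  rewrite -(mxrank_unit uB) BE; apply: leq_trans (mxrankM_maxl _ _) _.
  exact: rank_leq_col.
by case: (n) n1 => [|[]].
Qed.

(** Vectors of norm 1 are split off one by one; [norm1_exists] supplies them until dimension 1 is
    reached, so a single diagonal entry stays undetermined. *)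
Lemma F3_form_diag k (B : 'M['F_3]_k.+1) : B^T = B -> B \in unitmx ->
  exists S r, [/\ S \in unitmx, S *m B *m S^T = diag_mx r
                & forall j, j != 0 -> r 0 j = 1].
Proof.
elim: k B => [|k IHk] B symB uB.
  exists 1%:M, (const_mx (B 0 0)).
  rewrite unitmx1 mul1mx trmx1 mulmx1; split=> //.
    by rewrite [LHS]mx11_scalar diag_const_mx.
  by move=> j; rewrite [j]ord1.
have [v qv] := @norm1_exists k.+2 B isT symB uB.
have nz_v : v != 0.
  by apply: contra_eq_neq qv => ->; rewrite /bform !mul0mx mxE eq_sym oner_eq0.
pose e0 : 'rV['F_3]_k.+2 := delta_mx 0 0.
have e0v : e0 *m (e0^T *m v) = v.
  rewrite mulmxA trmx_delta mul_delta_mx (_ : delta_mx _ _ = 1%:M) ?mul1mx //.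
  by apply/matrixP=> i j; rewrite !ord1 !mxE.
(* [M] is an invertible matrix with first row [v]. *)
have [|M uM] := @complete_unitmx _ _ _ e0 (e0^T *m v).
  rewrite e0v !rank_rV nz_v; case: eqP => // /rowP/(_ 0)/eqP.
  by rewrite !mxE eqxx.
rewrite e0v => vM.
pose B1 : 'M_(1 + (1 + k)) := M *m B *m M^T.
have symB1 : B1^T = B1 by rewrite /B1 !trmx_mul trmxK symB mulmxA.
have ul1 : ulsubmx B1 = 1%:M.
  rewrite [LHS]mx11_scalar mxE mxE; congr _%:M.
  rewrite (_ : lshift _ 0 = 0); last exact/val_inj.
  by rewrite (@mulmx_bform k.+2) rowE -/e0 -vM.
have dlE : dlsubmx B1 = (ursubmx B1)^T by rewrite -[in LHS]symB1 -trmx_ursub.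
pose u := ursubmx B1.
(* Block elimination; [B2] is the Schur complement of the corner 1. *)
pose S1 : 'M_(1 + (1 + k)) := block_mx 1%:M 0 (- u^T) 1%:M.
pose B2 : 'M['F_3]_(1 + k) := drsubmx B1 - u^T *m u.
have S1E : S1 *m B1 *m S1^T = block_mx 1%:M 0 0 B2.
  rewrite -{1}[B1]submxK ul1 dlE -/u /S1 tr_block_mx !mulmx_block.
  rewrite !(trmx1, trmx0, mul1mx, mulmx1, mul0mx, mulmx0, addr0, add0r).
  by rewrite linearN /= trmxK !addNr mul0mx add0r mulNmx addrC.
have symB2 : B2^T = B2.
  by rewrite linearB /= trmx_mul trmxK trmx_drsub symB1.
have uS1 : S1 \in unitmx by rewrite unitmxE det_lblock !det1 mulr1 unitr1.
have uB2 : B2 \in unitmx.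
  suff : (block_mx 1%:M 0 0 B2 : 'M_(1 + (1 + k))) \in unitmx.
    by rewrite !unitmxE det_ublock det1 mul1r.
  by rewrite -S1E /B1 !unitmx_mul !unitmx_tr uS1 uM uB.
have [S2 [r [uS2 S2E r1]]] := IHk B2 symB2 uB2.
pose S3 : 'M_(1 + (1 + k)) := block_mx 1%:M 0 0 S2.
have uS3 : S3 \in unitmx by rewrite unitmxE det_ublock det1 mul1r.
(* The induction leaves the undetermined entry at index 1; the swap brings it to index 0. *)
pose p := perm_mx (tperm 0 (lift 0 0)) : 'M['F_3]_k.+2.
exists (p *m (S3 *m (S1 *m M))),
  (col_perm (tperm 0 (lift 0 0)) (row_mx 1%:M r)).
split.
- by rewrite !unitmx_mul unitmx_perm uS3 uS1 uM.
- rewrite -diag_mx_perm (diag_mx_row (1%:M : 'rV_1) r) -S2E.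
  have -> : diag_mx 1%:M = 1%:M :> 'M['F_3]_1.
    by apply/matrixP=> i j; rewrite !ord1 !mxE.
  have <- : S3 *m (S1 *m B1 *m S1^T) *m S3^T =
      block_mx 1%:M 0 0 (S2 *m B2 *m S2^T).
    rewrite S1E tr_block_mx !mulmx_block.
    by rewrite !(trmx1, trmx0, mul1mx, mulmx1, mul0mx, mulmx0, addr0, add0r).
  by rewrite !trmx_mul !mulmxA.
move=> j j0; rewrite mxE; case: tpermP => [j_0 | _ | _ jn1].
- by rewrite j_0 eqxx in j0.
- have -> : 0 = lshift k.+1 (ord0 : 'I_1) :> 'I_k.+2 by exact/val_inj.
  by apply: etrans (row_mxEl _ _ _ _) _; rewrite mxE.
case: (unliftP ord0 j) => [j' jE | jE]; last by rewrite jE in j0.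
rewrite (_ : j = rshift 1 j'); last by rewrite jE; apply/val_inj.
apply: etrans (row_mxEr _ _ _ _) _.
rewrite r1 //; apply: contra_not_neq jn1 => j'0.
by rewrite jE j'0.
Qed.

(** * Equidistant vectors, first for a diagonal form and then in general *)

Lemma diag_form_equidistant p q (r : 'rV['F_3]_(1 + (p + q))) : (3 %| p)%N ->
  r 0 0 = -1 -> (forall j, j != 0 -> r 0 j = 1) ->
  exists (U : 'M_(3 + p, 1 + (p + q))) (a : 'cV_(3 + p)),
    U *m diag_mx r *m U^T = 1%:M + (a *m const_mx 1 + (a *m const_mx 1)^T).
Proof.
move=> p3 r0 r1.
have rE : r = row_mx (const_mx (-1)) (const_mx 1).
  apply/rowP=> j; rewrite -[j]splitK; case: (split j) => i /=.
    rewrite row_mxEl mxE -[RHS]r0; congr (r 0 _); rewrite ord1.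
    exact/val_inj.
  by rewrite row_mxEr mxE r1.
(* The three special vectors are (c_i; t_i, ..., t_i, 0, ..., 0). As 3 divides [p], their middle
   parts are isotropic and mutually orthogonal, so the condition on them is - c_i c_j = [i = j] +
   t_i + t_j, which c = (0, 1, -1) and t = (1, -1, -1) satisfy. Their products with the basis
   vectors are the t_i, so [a] is [t] followed by zeros. *)
pose c : 'cV['F_3]_3 := \col_i (i : nat)%:R.
pose t : 'cV['F_3]_3 := \col_i (if i == 0 then 1 else -1).
pose one : 'rV['F_3]_p := const_mx 1.
pose L1 : 'M['F_3]_(3, p + q) := row_mx (t *m one) 0.
pose L2 : 'M['F_3]_(p, p + q) := row_mx 1%:M 0.
have oneE : one *m one^T = 0.
  apply/matrixP=> i j; rewrite !mxE (eq_bigr (fun=> 1)) => [|k _].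
    rewrite sumr_const card_ord F3_natr; case/dvdnP: p3 => u ->.
    by rewrite modnMl.
  by rewrite !mxE mulr1.
have L11 : L1 *m L1^T = 0.
  rewrite tr_row_mx mul_row_col trmx0 mulmx0 addr0 trmx_mul -mulmxA.
  by rewrite (mulmxA one) oneE mul0mx mulmx0.
have L12 : L1 *m L2^T = t *m one.
  by rewrite !tr_row_mx mul_row_col !trmx0 mulmx0 addr0 trmx1 mulmx1.
have L22 : L2 *m L2^T = 1%:M.
  by rewrite !tr_row_mx mul_row_col !trmx0 mulmx0 addr0 trmx1 mulmx1.
have L21 : L2 *m L1^T = (t *m one)^T by rewrite -L12 trmx_mul trmxK.
have ccE : - (c *m c^T) = 1%:M + (t *m const_mx 1 + (t *m const_mx 1)^T).
  apply/matrixP=> i j; rewrite !mxE !big_ord1 !mxE.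
  by case: i => -[|[|[|]]] //= lt_i; case: j => -[|[|[|]]] //= lt_j;
    apply/val_inj.
exists (block_mx c L1 0 L2), (col_mx t 0).
clearbody L1 L2.
rewrite rE diag_mx_row !diag_const_mx tr_block_mx !mulmx_block trmx0.
rewrite !(mul0mx, mulmx0, addr0, add0r, mulmx1) L11 L12 L22 L21 addr0.
rewrite mul_mx_scalar scaleN1r mulNmx ccE.
have -> : (const_mx 1 : 'rV_(3 + p)) = row_mx (const_mx 1) one.
  by rewrite row_mx_const.
rewrite mul_col_row !mul0mx tr_block_mx !trmx0 (scalar_mx_block 3 p).
by rewrite !add_block_mx !(addr0, add0r).
Qed.

Lemma equidistant_exists n (B : 'M['F_3]_n.-1.+1) m :
  (3 <= n)%N -> B^T = B -> \det B = -1 ->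
  (3 %| m)%N -> (n <= m <= n + 2)%N ->
  exists (U : 'M_(m, n.-1.+1)) (a : 'cV_m),
    U *m B *m U^T = 1%:M + (a *m const_mx 1 + (a *m const_mx 1)^T).
Proof.
move=> n3 symB detB m3 /andP[le_nm le_mn].
have uB : B \in unitmx by rewrite unitmxE detB unitrN1.
have [S [r [uS SE r1]]] := F3_form_diag symB uB.
(* Comparing determinants fixes the remaining entry, as (det S)^2 = 1. *)
have r0 : r 0 0 = -1.
  have := congr1 determinant SE.
  rewrite !det_mulmx det_tr detB mulrN1 mulNr -expr2.
  rewrite F3_sqr -?unitfE -?unitmxE // det_diag big_ord_recl.
  rewrite big1 ?mulr1 => [->//|j _].
  by rewrite r1.
have [p [q [mE nE]]] : exists p q, m = (3 + p)%N /\ n.-1 = (p + q)%N.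
  exists (m - 3)%N, (n + 2 - m)%N; lia.
move: B symB detB uB S r SE uS r1 r0; rewrite nE mE => B _ _ _ S r SE _ r1 r0.
have [|U [a UE]] := @diag_form_equidistant p q r _ r0 r1.
  by rewrite mE dvdn_addr in m3.
by exists (U *m S), a; rewrite trmx_mul -UE -SE !mulmxA.
Qed.

(** * Comparison of the bounds for each residue of [n] modulo 3 *)

Theorem proposition5 (n : nat) (hn : (4 <= n)%N)
    (B : 'M['F_3]_n.-1.+1) (symB : B^T = B) (detB : \det B = -1)
    (gT : finGroupType) (G : {group gT})
    (f : {morphism PO_group B >-> gT}) (isoG : isom (PO_group B) G f)
    (D : {set gT}) (defD : D = f @: PO_reflections B) :
  [/\ n = 0 %[mod 3] -> varphi_is G D n,
      n = 2 %[mod 3] -> varphi_is G D (n + 1)%N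
    & n = 1 %[mod 3] -> varphi_is G D (n + 2)%N].
Proof.
have n3 : (2 < n)%N by exact: ltnW.
have nE : n.-1.+1 = n by rewrite prednK // (leq_trans _ hn).
have lower m : (3 %| m)%N -> (n <= m <= n + 2)%N -> sym_embeds G D m.
  move=> m3 m_n; have [U [a UBU]] := equidistant_exists n3 symB detB m3 m_n.
  rewrite defD; apply: (equidistant_embeds isoG UBU); lia.
have rank_bound k l : sym_embeds G D k -> (l < k)%N ->
    l.+1%:R != 0 :> 'F_3 -> (l <= n)%N.
  rewrite defD => Dk lk; rewrite -nE.
  have [V] := embedded_roots_gram isoG symB n3 lk Dk.
  exact: path_gram_rank.
have disc_bound k : sym_embeds G D k -> (n < k)%N -> n.+1%:R != 1 :> 'F_3.
  rewrite defD => Dk; rewrite -{1}nE => nk.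
  have [V pV] := embedded_roots_gram isoG symB n3 nk Dk.
  by have := path_gram_disc pV detB; rewrite nE.
have natr_mod k l : (k %% 3 = l)%N -> k%:R = l%:R :> 'F_3.
  by move=> <-; exact: F3_natr.
split=> n_mod; (split; first by apply: lower; lia).
(* Here [l = n] is used: the determinant n + 1 would be 1, against [disc_bound]. *)
- move=> k Dk; rewrite leqNgt; apply/negP=> nk.
  by have := disc_bound k Dk nk; rewrite (natr_mod _ 1%N) ?eqxx //; lia.
(* Here [l = n + 1], with determinant n + 2 = 1 modulo 3. *)
- move=> k Dk; rewrite leqNgt; apply/negP=> nk.
  have : (n.+1 <= n)%N; last by rewrite ltnn.
  apply: rank_bound Dk _ _; first lia.
  by rewrite (natr_mod _ 1%N) //; lia.
(* Here [l = n + 2], with determinant n + 3 = 1 modulo 3; smaller [l] need not give a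
   contradiction. *)
move=> k Dk; rewrite leqNgt; apply/negP=> nk.
have : (n.+2 <= n)%N; last by lia.
apply: rank_bound Dk _ _; first lia.
by rewrite (natr_mod _ 1%N) //; lia.
Qed.
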